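(* Let $\mu$ be a monotone measure on $(X,\mathcal{B})$, and let $\mathcal{S}$ be one of the classes $\mathcal{S}^{P+},\ \mathcal{S}^{P\pm},\ \mathcal{S}^{P+}_\mu,\ \mathcal{S}^{P\pm}_\mu$. Assume that $M=\int^{\uparrow}_{\mathcal{S}} 1_X\, d\mu<\infty$. Let $\{f_n\}_{n\in\mathbb{N}}$ be a sequence of nonnegative measurable functions which converges to $f$ uniformly on $X$, and suppose $\int^{\uparrow}_{\mathcal{S}} f\, d\mu<\infty$; moreover, assume that $f$ and $f_n$ ($n\in\mathbb{N}$) are nonnegative if $\mathcal{S}=\mathcal{S}^{P+}$ or $\mathcal{S}^{P+}_\mu$. Then $$\lim_{n\to\infty}\int^{\uparrow}_{\mathcal{S}} f_n\, d\mu=\int^{\uparrow}_{\mathcal{S}} f\, d\mu .$$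
   Context: $(X,\mathcal{B})$ is a measurable space ($\mathcal{B}$ a $\sigma$-algebra on $X$). Measurable functions are real-valued. $1_A$ denotes the indicator function of $A$. A monotone measure is a set function $\mu:\mathcal{B}\to[0,\infty)$ with $\mu(\emptyset)=0$ and $\mu(A)\le\mu(B)$ whenever $A\subset B$; throughout, every monotone measure is assumed to be continuous from above and below, i.e. $A_n\nearrow A$ or $A_n\searrow A$ implies $\mu(A_n)\to\mu(A)$. No additivity is assumed. A simple function is a finite or infinite sequence of pairs $\varphi=\{(a_k,A_k)\}_k$ with $a_k\in\mathbb{R}$, $A_k\in\mathcal{B}$; it is identified with the function $\varphi(x)=\sum_k a_k 1_{A_k}(x)$, but its basic sum $\mu(\varphi)=\sum_k a_k\mu(A_k)$ depends on the sequence of pairs. A partition of $X$ is a family of pairwise disjoint sets in $\mathcal{B}$ with union $X$. The classes are: - $\mathcal{S}^{P+}$: all finite sequences $\{(a_k,A_k)\}_{k=1}^n$, $n\in\mathbb{N}$, with $a_k\ge 0$ and $\{A_k\}_k$ a partition of $X$; - $\mathcal{S}^{P\pm}$: all finite sequences $\{(a_k,A_k)\}_{k=1}^n$, $n\in\mathbb{N}$, with $a_k\in\mathbb{R}$ and $\{A_k\}_k$ a partition of $X$; - $\mathcal{S}^{P+}_\mu$: all infinite sequences $\{(a_k,A_k)\}_{k=1}^\infty$ with $a_k\ge 0$, $\sum_k a_k\mu(A_k)<\infty$ and $\{A_k\}_k$ a partition of $X$; - $\mathcal{S}^{P\pm}_\mu$: all infinite sequences $\{(a_k,A_k)\}_{k=1}^\infty$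 with $a_k\in\mathbb{R}$, $\sum_k |a_k|\mu(A_k)<\infty$ and $\{A_k\}_k$ a partition of $X$. (Members of a partition may be empty.) For a class $\mathcal{S}$ and a measurable function $f$, $L(\mathcal{S},f)=\{\varphi\in\mathcal{S}:\varphi(x)\le f(x)\ \forall x\in X\}$ and $\int^{\uparrow}_{\mathcal{S}} f\,d\mu=\sup\{\mu(\varphi):\varphi\in L(\mathcal{S},f)\}$, taken in the extended reals. *)

(* Defs.v *)
From HB Require Import structures.
From mathcomp Require Export all_boot all_order all_algebra.
From mathcomp Require Export all_classical all_reals all_analysis.

Export Order.TTheory GRing.Theory Num.Theory.
Export numFieldNormedType.Exports.

#[export] Set Implicit Arguments.
#[export] Unset Strict Implicit.
#[export] Unset Printing Implicit Defensive.

Local Open Scope classical_set_scope.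
Local Open Scope ring_scope.

(* [mu] is a total function on [set T]; only its values on measurable sets are
   constrained, or used below. *)
Record monotone_measure (d : measure_display) (T : measurableType d)
    (R : realType) (mu : set T -> R) : Prop := MonotoneMeasure {
  mm_ge0 : forall A, measurable A -> 0 <= mu A ;
  mm_set0 : mu set0 = 0 ;
  mm_le : forall A B, measurable A -> measurable B ->
    A `<=` B -> mu A <= mu B ;
  mm_cvg_below : forall A : (set T)^nat, (forall n, measurable (A n)) ->
    nondecreasing_seq A -> mu (A n) @[n --> \oo] --> mu (\bigcup_n A n) ;
  mm_cvg_above : forall A : (set T)^nat, (forall n, measurable (A n)) ->
    nonincreasing_seq A -> mu (A n) @[n --> \oo] --> mu (\bigcap_n A n) }.

(* A finite or infinite sequence of pairs (a_k, A_k). Different sequences may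
   define the same function on [T] and still have different basic sums. *)
Inductive simple_seq (T : Type) (R : Type) : Type :=
| FinSeq (n : nat) (a : 'I_n -> R) (A : 'I_n -> set T)
| InfSeq (a : nat -> R) (A : nat -> set T).

Section simple_sequences.
Context (d : measure_display) (T : measurableType d) (R : realType).
Implicit Types (mu : set T -> R) (phi : simple_seq T R) (f : T -> R).

(* The two functions below are valued in \bar R because the infinite sums are
   limits of partial sums in \bar R. *)
Definition simple_eval phi (x : T) : \bar R :=
  match phi with
  | FinSeq n a A => \sum_(k < n) (a k * \1_(A k) x)%:E
  | InfSeq a A => \sum_(0 <= k <oo) (a k * \1_(A k) x)%:E
  end%E.

Definition basic_sum mu phi : \bar R :=
  match phi with
  | FinSeq n a A => \sum_(k < n) (a k * mu (A k))%:E
  | InfSeq a A => \sum_(0 <= k <oo) (a k * mu (A k))%:E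
  end%E.

(* Disjointness is between distinct indices, so the empty set may be repeated. *)
Definition mpartition (I : Type) (A : I -> set T) : Prop :=
  [/\ forall i, measurable (A i), trivIset setT A & \bigcup_i A i = setT].

Definition SPplus : set (simple_seq T R) := fun phi =>
  if phi is FinSeq n a A then (forall k, 0 <= a k) /\ mpartition A else False.

Definition SPpm : set (simple_seq T R) := fun phi =>
  if phi is FinSeq n a A then mpartition A else False.

Definition SPplus_mu mu : set (simple_seq T R) := fun phi =>
  if phi is InfSeq a A then
    [/\ forall k, 0 <= a k,
        (\sum_(0 <= k <oo) (a k * mu (A k))%:E < +oo)%E
      & mpartition A]
  else False.

Definition SPpm_mu mu : set (simple_seq T R) := fun phi =>
  if phi is InfSeq a A then
    (\sum_(0 <= k <oo) (`|a k| * mu (A k))%:E < +oo)%E /\ mpartition A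
  else False.

Definition lower_simple (S : set (simple_seq T R)) f : set (simple_seq T R) :=
  [set phi | S phi /\ forall x, (simple_eval phi x <= (f x)%:E)%E].

Definition integral_up (S : set (simple_seq T R)) mu f : \bar R :=
  ereal_sup [set basic_sum mu phi | phi in lower_simple S f].

End simple_sequences.

Arguments SPplus {d T R}.
Arguments SPpm {d T R}.

(* Main.v *)
Require Import Defs.
From mathcomp Require Import lra.
Local Open Scope classical_set_scope.
Local Open Scope ring_scope.

(* If [|g - f| <= c] and [f >= 0], replacing every coefficient [a] of a simple
   function below [g] by [max (a - c) 0] gives a simple function of the same
   class below [f]. On a partition this lowers the basic sum by at most
   [c * \sum_k mu (A_k)], and [\sum_k mu (A_k)] is at most the integral [M] of
   [1_X]. Hence the integral of [g] is at most that of [f] plus [c * M], and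
   the roles of [f] and [g] can be exchanged. *)

(** Termwise from [a <= max (a - c) 0 + c], with nonnegative weights, which will be the
    [mu (A k)]. *)
Lemma sum_le_truncated (R : realDomainType) (I : Type) (r : seq I)
    (a m : I -> R) (c : R) :
  (forall k, 0 <= m k) ->
  \sum_(k <- r) a k * m k <=
  \sum_(k <- r) Num.max (a k - c) 0 * m k + c * \sum_(k <- r) m k.
Proof.
move=> m0; rewrite mulr_sumr -big_split /=; apply: ler_sum => k _.
rewrite -mulrDl ler_wpM2r// -lerBlDr.
by rewrite le_max lexx.
Qed.

Lemma truncated_ge0 (R : realDomainType) (a c : R) : 0 <= Num.max (a - c) 0.
Proof. by rewrite le_max lexx orbT. Qed.

(** This domination makes the truncation of an absolutely summable sequence summable. *)
Lemma truncated_le_norm (R : realDomainType) (a c : R) :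
  0 <= c -> Num.max (a - c) 0 <= `|a|.
Proof.
move=> c0; rewrite ge_max normr_ge0 andbT.
by rewrite (le_trans _ (ler_norm a))// gerBl.
Qed.

Section simple_sequences.
Context (d : measure_display) (X : measurableType d) (R : realType).
Implicit Types (mu : set X -> R) (S : set (simple_seq X R)) (f g : X -> R).

Lemma trivIset_indic (I : eqType) (A : I -> set X) (x : X) (k i : I) :
  trivIset setT A -> A k x -> \1_(A i) x = (i == k)%:R :> R.
Proof.
move=> tA Akx; rewrite indicE; have [->|ik] := eqVneq i k.
  by rewrite mem_set.
rewrite memNset// => Aix; move/eqP: ik; apply.
by apply: tA => //; exists x.
Qed.

(** At each point exactly one term of the sum has a nonzero indicator. Being below [f] thus becomes
    a condition on single coefficients, which is easy to check after truncation. *)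
Lemma FinSeq_le_iff n (a : 'I_n -> R) (A : 'I_n -> set X) f :
  mpartition A ->
  (forall x, (simple_eval (FinSeq a A) x <= (f x)%:E)%E) <->
  (forall k x, A k x -> a k <= f x).
Proof.
move=> [_ tA cA].
have evalE k x : A k x -> simple_eval (FinSeq a A) x = (a k)%:E.
  move=> Akx; rewrite /= sumEFin (bigD1 k)//= big1 => [|i ik].
    by rewrite (trivIset_indic k tA Akx) eqxx mulr1 addr0.
  by rewrite (trivIset_indic i tA Akx) (negbTE ik) mulr0.
split=> [le_f k x Akx|le_f x]; first by rewrite -lee_fin -(evalE _ _ Akx).
have [k _ Akx] : (\bigcup_i A i) x by rewrite cA.
by rewrite (evalE _ _ Akx) lee_fin le_f.
Qed.

Lemma InfSeq_le_iff (a : nat -> R) (A : nat -> set X) f :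
  mpartition A ->
  (forall x, (simple_eval (InfSeq a A) x <= (f x)%:E)%E) <->
  (forall k x, A k x -> a k <= f x).
Proof.
move=> [_ tA cA].
have evalE k x : A k x -> simple_eval (InfSeq a A) x = (a k)%:E.
  (* The partial sums at [x] are constant once they include the index [k]. *)
  move=> Akx; rewrite /=; apply: lim_near_cst => //.
  exists k.+1 => // n /= kn.
  rewrite sumEFin (bigD1_seq k) ?iota_uniq ?mem_index_iota//= big1 => [|i ik].
    by rewrite (trivIset_indic k tA Akx) eqxx mulr1 addr0.
  by rewrite (trivIset_indic i tA Akx) (negbTE ik) mulr0.
split=> [le_f k x Akx|le_f x]; first by rewrite -lee_fin -(evalE _ _ Akx).
have [k _ Akx] : (\bigcup_i A i) x by rewrite cA.
by rewrite (evalE _ _ Akx) lee_fin le_f.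
Qed.

Lemma mpartition_setT_set0 (I : eqType) (i0 : I) :
  mpartition (fun i : I => if i == i0 then [set: X] else set0).
Proof.
split=> [i||]; first by case: ifP.
  by move=> i j _ _ [x []]; do 2 case: eqP => // ->.
by apply/seteqP; split => // x _; exists i0; rewrite ?eqxx.
Qed.

Section integral.
Context (mu : set X -> R) (hmu : monotone_measure mu).

(** The coefficients are all [1]. Without additivity the total mass of a partition may exceed
    [mu setT], so the bound has to come from the integral of the constant [1]. *)
Lemma FinSeq_mass_le S n (A : 'I_n -> set X) :
  SPplus `<=` S -> mpartition A ->
  ((\sum_(k < n) mu (A k))%:E <= integral_up S mu \1_[set: X])%E.
Proof.
move=> plusS pA; apply: ereal_sup_ubound.
exists (FinSeq (fun=> 1) A); last first.
  by rewrite /= sumEFin; congr EFin; apply: eq_bigr => k _; rewrite mul1r.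
split; first exact: plusS.
by apply/FinSeq_le_iff => // k x _; rewrite indicT.
Qed.

(* The coefficients are [1] up to [n] and [0] afterwards: the constant sequence
   [1] is not yet known to have a finite basic sum. *)
Lemma InfSeq_mass_le S n (A : nat -> set X) :
  SPplus_mu mu `<=` S -> mpartition A ->
  ((\sum_(0 <= k < n) mu (A k))%:E <= integral_up S mu \1_[set: X])%E.
Proof.
move=> plusS pA; apply: ereal_sup_ubound.
have sumE : (\sum_(0 <= k <oo) ((k < n)%:R * mu (A k))%:E =
    (\sum_(0 <= k < n) mu (A k))%:E)%E.
  apply: lim_near_cst => //; exists n => // N /= nN.
  rewrite (big_cat_nat (leq0n n) nN)//= [X in (_ + X)%E]big_nat_cond.
  rewrite [X in (_ + X)%E]big1 => [|k /andP[/andP[nk _] _]].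
    rewrite adde0 -sumEFin; apply: eq_big_nat => k /andP[_ kn].
    by rewrite kn mul1r.
  by rewrite ltnNge nk mul0r.
exists (InfSeq (fun k => (k < n)%:R) A) => //; split.
  by apply: plusS; split=> //; rewrite sumE ltry.
by apply/InfSeq_le_iff => // k x _; rewrite indicT lern1 leq_b1.
Qed.

(** The truncated coefficients are nonnegative, so the new sequence lies in [SPplus] or
    [SPplus_mu mu], and [S] contains that class; signed and unsigned classes are thus treated
    together. Truncating at [0] stays below [f] because [f] is nonnegative. *)
Lemma integral_up_shift S f g (c : R) :
  [\/ S = SPplus, S = SPpm, S = SPplus_mu mu | S = SPpm_mu mu] ->
  0 <= c -> (forall x, 0 <= f x) -> (forall x, g x <= f x + c) ->
  (integral_up S mu g <=
   integral_up S mu f + c%:E * integral_up S mu \1_[set: X])%E.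
Proof.
move=> hS c0 f0 gf; apply: ge_ereal_sup => _ [phi [Sphi phig] <-].
have m0 (I : Type) (A : I -> set X) : mpartition A -> forall k, 0 <= mu (A k).
  by move=> [mA _ _] k; exact: (mm_ge0 hmu).
have le_f (I : Type) (A : I -> set X) (a : I -> R) :
    (forall k x, A k x -> a k <= g x) ->
    forall k x, A k x -> Num.max (a k - c) 0 <= f x.
  move=> ag k x Akx; rewrite ge_max f0 andbT lerBlDr.
  exact: le_trans (ag _ _ Akx) (gf x).
case: phi Sphi phig => [n a A|a A] Sphi phig.
- have [plusS pA] : SPplus `<=` S /\ mpartition A.
    case: hS Sphi => -> //= => [[]|]; do ?[by []|by split].
    by move=> pA; split=> // -[? ? ? []|].
  set b := fun k => Num.max (a k - c) 0.
  apply: (@le_trans _ _ (basic_sum mu (FinSeq b A)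
      + c%:E * (\sum_(k < n) mu (A k))%:E))%E.
    rewrite /= !sumEFin -EFinM -EFinD lee_fin.
    by apply: sum_le_truncated; exact: m0.
  apply: leeD; last by rewrite lee_wpmul2l ?lee_fin// FinSeq_mass_le.
  apply: ereal_sup_ubound; eexists; last reflexivity.
  split; first by apply: plusS; split=> // k; exact: truncated_ge0.
  by apply/FinSeq_le_iff => //; apply: le_f; apply/FinSeq_le_iff.
(* Both infinite classes give absolute summability: for nonnegative coefficients the norm changes
   nothing. *)
have [plusS pA sumA] : [/\ SPplus_mu mu `<=` S, mpartition A &
    (\sum_(0 <= k <oo) (`|a k| * mu (A k))%:E < +oo)%E].
  case: hS Sphi => -> //=.
    move=> [a0 fa pA]; split=> //; apply: le_lt_trans fa.
    by under eq_eseriesr do rewrite ger0_norm//.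
  move=> [fa pA]; split=> // -[//|b B [b0 fb pB]]; split=> //.
  by under eq_eseriesr do rewrite ger0_norm//.
set b := fun k => Num.max (a k - c) 0.
have b_ge0 k : (0 <= (b k * mu (A k))%:E)%E.
  by rewrite lee_fin mulr_ge0 ?truncated_ge0 ?m0.
(* The terms may have any sign, so the limit defining the basic sum exists by absolute convergence;
   it can then be bounded through its partial sums. *)
have cvg_phi : cvgn (fun n => \sum_(0 <= k < n) (a k * mu (A k))%:E)%E.
  have /cvg_ex[l al] : cvgn (series (fun k => a k * mu (A k))).
    apply: normed_cvg; apply: nnseries_is_cvg => [k|]; first exact: normr_ge0.
    apply: le_lt_trans sumA.
    by under eq_eseriesr do rewrite /= normrM (ger0_norm (m0 _ _ pA _)).
  apply/cvg_ex; exists l%:E.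
  by under eq_fun do rewrite sumEFin; exact: cvg_comp _ _ al _.
apply: lime_le => //; apply: nearW => n.
apply: (@le_trans _ _ (\sum_(0 <= k < n) (b k * mu (A k))%:E
    + c%:E * (\sum_(0 <= k < n) mu (A k))%:E))%E.
  rewrite !sumEFin -EFinM -EFinD lee_fin.
  by apply: sum_le_truncated; exact: m0.
apply: leeD; last by rewrite lee_wpmul2l ?lee_fin// InfSeq_mass_le.
apply: (@le_trans _ _ (basic_sum mu (InfSeq b A))).
  by apply: nneseries_lim_ge => k _ _; exact: b_ge0.
apply: ereal_sup_ubound; eexists; last reflexivity.
split; last by apply/InfSeq_le_iff => //; apply: le_f; apply/InfSeq_le_iff.
apply: plusS; split=> // [k|]; first exact: truncated_ge0.
apply: le_lt_trans sumA; apply: lee_nneseries => [k _ _|k _]; first exact: b_ge0.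
by rewrite lee_fin ler_wpM2r ?m0 ?truncated_le_norm.
Qed.

(** Every class contains a sequence with zero coefficients on the partition into [setT] and empty
    sets; its basic sum is [0]. *)
Lemma integral_up_ge0 S f :
  [\/ S = SPplus, S = SPpm, S = SPplus_mu mu | S = SPpm_mu mu] ->
  (forall x, 0 <= f x) -> (0 <= integral_up S mu f)%E.
Proof.
move=> hS f0; apply: ereal_sup_ubound.
have := mpartition_setT_set0 (ord0 : 'I_1); set F := (F in mpartition F) => pF.
have := mpartition_setT_set0 0%N; set I := (I in mpartition I) => pI.
have phi_le phi : phi = FinSeq (fun=> 0) F \/ phi = InfSeq (fun=> 0) I ->
    S phi -> [set basic_sum mu phi | phi in lower_simple S f] 0%E.
  move=> phiE Sphi; exists phi.
    by split=> //; case: phiE => ->; [apply/FinSeq_le_iff|apply/InfSeq_le_iff].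
  case: phiE => -> /=; first by rewrite big1// => k _; rewrite mul0r.
  by rewrite eseries0// => k _ _; rewrite mul0r.
case: hS phi_le => -> phi_le.
- by apply: phi_le; [left; reflexivity|].
- by apply: phi_le; [left; reflexivity|].
- apply: phi_le; [by right; reflexivity|split=> //].
  by rewrite eseries0// => k _ _; rewrite mul0r.
- apply: phi_le; [by right; reflexivity|split=> //].
  by rewrite eseries0// => k _ _; rewrite normr0 mul0r.
Qed.

End integral.
End simple_sequences.

Lemma uniform_cvg_dist (T : choiceType) (R : realType) (f_ : nat -> T -> R)
    (f : T -> R) : {uniform, f_ @ \oo --> f} ->
  forall e : R, 0 < e -> \forall n \near \oo, forall x, `|f x - f_ n x| < e.
Proof.
move=> hunif e e0.
(* The entourage of pairs at distance less than [e] yields the required neighbourhood of [f] for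
   uniform convergence. *)
pose E : set (R * R) := [set xy | ball xy.1 e xy.2].
have /hunif : nbhs (f : {uniform T -> R}) [set h : T -> R | forall x, `|f x - h x| < e].
  apply/uniform_nbhs; exists E; split; first exact: (@entourage_ball _ R^o (PosNum e0)).
  by move=> h /= hE x; exact: hE.
by [].
Qed.

Theorem theorem6 (d : measure_display) (X : measurableType d) (R : realType)
  (mu : set X -> R) (hmu : monotone_measure mu)
  (S : set (simple_seq X R))
  (hS : [\/ S = SPplus, S = SPpm, S = SPplus_mu mu | S = SPpm_mu mu])
  (hM : (integral_up S mu \1_[set: X] < +oo)%E)
  (f_ : nat -> X -> R) (f : X -> R)
  (hmeas : forall n, measurable_fun [set: X] (f_ n))
  (hf_ge0 : forall n x, 0 <= f_ n x)
  (hunif : {uniform, f_ @ \oo --> f})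
  (hf : (integral_up S mu f < +oo)%E)
  (hplus : S = SPplus \/ S = SPplus_mu mu ->
     (forall x, 0 <= f x) /\ (forall n x, 0 <= f_ n x)) :
  integral_up S mu (f_ n) @[n --> \oo] --> integral_up S mu f.
Proof.
have dist := uniform_cvg_dist hunif.
have f0 x : 0 <= f x.
  (* Nonnegativity passes to the limit: [f x > f_ n x - e >= - e] for some [n], whatever [e > 0]. *)
  apply/ler_addgt0Pl => e e0.
  have [n _ /(_ n (leqnn n) x)] := dist _ e0.
  by rewrite ltr_norml => /andP[ef _]; have := hf_ge0 n x; lra.
have M0 : (0 <= integral_up S mu \1_[set: X])%E.
  by apply: integral_up_ge0 => // x; rewrite indicE.
have If0 := integral_up_ge0 hS f0.
have shift n (c : R) : 0 <= c -> (forall x, `|f x - f_ n x| <= c) ->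
    (integral_up S mu (f_ n) <=
       integral_up S mu f + c%:E * integral_up S mu \1_[set: X])%E /\
    (integral_up S mu f <=
       integral_up S mu (f_ n) + c%:E * integral_up S mu \1_[set: X])%E.
  move=> c0 fc; split; apply: integral_up_shift => // x;
    by have := fc x; rewrite ler_norml => /andP[]; lra.
have Ifn0 n := integral_up_ge0 hS (hf_ge0 n).
move: M0 hM If0 hf shift.
case: (integral_up S mu \1_[set: X]) => [M| |]// M0 _.
case: (integral_up S mu f) => [I| |]// I0 _ shift.
rewrite lee_fin in M0.
(* The shift bound with [c = 1] makes the integrals at most [I + M] eventually, so the convergence
   can be proved in the reals. *)
have Ifn_fin : \forall n \near \oo, integral_up S mu (f_ n) \is a fin_num.
  near=> n; rewrite ge0_fin_numE//.
  have [|/le_lt_trans -> //] := shift n 1 ler01 _.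
    by move=> x; apply: ltW; move: x; near: n; exact: dist.
  by rewrite -EFinM -EFinD ltry.
apply/fine_cvgP; split => //; apply/cvgrPdist_le => e e0.
(* The denominator is [M + 1] because [M] may be [0]; the error [c * M] is still at most [e]. *)
have c0 : 0 < e / (M + 1) by rewrite divr_gt0// ltr_wpDl.
near=> n.
have fin_n : integral_up S mu (f_ n) \is a fin_num by near: n.
have [|] := shift n _ (ltW c0) _.
  by move=> x; apply: ltW; move: x; near: n; exact: dist.
have cM : e / (M + 1) * M <= e.
  by rewrite mulrAC ler_pdivrMr ?ltr_wpDl// ler_wpM2l ?lerDl// ltW.
rewrite /=; case: (integral_up S mu (f_ n)) fin_n => [J| |]// _.
rewrite -EFinM -!EFinD !lee_fin => le1 le2.
by rewrite /= ler_norml; apply/andP; split; lra.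
Unshelve. all: by end_near.
Qed.
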